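(* For Vertex Cover in the standard model, the strict competitive ratio is $n-1$, where $n$ is the number of vertices of the input graph. That is: (i) there is an online algorithm $\mathrm{ALG}$ in the standard model such that $\mathrm{ALG}(\sigma)\le (n-1)\,\mathrm{OPT}(\sigma)$ for every input $\sigma$ with $n\ge1$ vertices; and (ii) for every online algorithm $\mathrm{ALG}$ in the standard model and every integer $n\ge 1$, every real $c\ge 0$ such that $\mathrm{ALG}(\sigma)\le c\,\mathrm{OPT}(\sigma)$ for all inputs $\sigma$ with $n$ vertices satisfies $c\ge n-1$.
   Context: Online Vertex Cover (vertex arrival). An input $\sigma$ is a finite simple undirected graph $G=(V,E)$ together with an ordering of its vertices. Vertices arrive one by one in this order; when a vertex arrives, all edges between it and previously arrived vertices are revealed. All online algorithms are deterministic: each decision depends only on the part of the input revealed so far (in particular $n=|V|$ is not known in advance). After each arrival has been processed, the set of currently accepted vertices must be a vertex cover of the graph revealed so far (every edge has at least one accepted endpoint). $\mathrm{ALG}(\sigma)$ is the number of accepted vertices at the end of the input, and $\mathrm{OPT}(\sigma)$ is the minimum cardinality of a vertex cover of $G$; the objective is minimization. Standard model: upon arrival of a vertex, the algorithm must immediately and irrevocably either accept or reject it. *)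

(* Defs.v *)
From mathcomp Require Import all_boot.

Set Implicit Arguments.
Unset Strict Implicit.
Unset Printing Implicit Defensive.

Record sgraph (V : finType) := SGraph {
  edges : {set {set V}};
  card_edges : [forall e in edges, #|e| == 2]
}.

Definition is_vertex_cover (V : finType) (G : sgraph V) (C : {set V}) : bool :=
  [forall e in edges G, ~~ [disjoint e & C]].

(* The default [set: V] of the arg min is itself a vertex cover, as edges are
   nonempty. *)
Definition min_vertex_cover (V : finType) (G : sgraph V) : nat :=
  #|[arg min_(C < [set: V] | is_vertex_cover G C) #|C| ]|.

(* The vertex [arrival i] is the one that arrives after exactly i others. *)
Record vc_input (n : nat) := VCInput {
  vertex : finType;
  graph : sgraph vertex;
  arrival : 'I_n -> vertex;
  arrival_bij : bijective arrival
}.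

Definition revealed_edges n (s : vc_input n) k (le_kn : k <= n) :
    {set {set 'I_k}} :=
  [set e : {set 'I_k} |
     [set arrival s (widen_ord le_kn i) | i in e] \in edges (graph s)].

Lemma card_revealed_edges n (s : vc_input n) k (le_kn : k <= n) :
  [forall e in revealed_edges s le_kn, #|e| == 2].
Proof.
apply/forall_inP => e; rewrite inE => /(forall_inP (card_edges (graph s))).
rewrite card_imset // => i j /(bij_inj (arrival_bij s)) /(congr1 val) /= eq_ij.
exact: val_inj.
Qed.

(* The part of the input revealed after k arrivals: the subgraph induced by
   the first k vertices, each named by its arrival position.  Neither n nor
   the type of vertices of the whole input can be recovered from it. *)
Definition revealed n (s : vc_input n) k (le_kn : k <= n) : sgraph 'I_k :=
  SGraph (card_revealed_edges s le_kn).

(* The decision (true = accept) on the vertex that has just arrived, namely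
   ord_max, from the graph revealed up to and including it. *)
Definition decision_rule := forall k : nat, sgraph 'I_k.+1 -> bool.

(* The arrival positions of the vertices accepted during the first k arrivals.
   Each decision is taken once, from the graph revealed at the arrival of its
   vertex, hence is irrevocable. *)
Definition accepted (D : decision_rule) n (s : vc_input n) k (le_kn : k <= n) :
    {set 'I_k} :=
  [set i : 'I_k | D i (revealed s (leq_trans (ltn_ord i) le_kn))].

Record online_alg := OnlineAlg {
  decide :> decision_rule;
  decide_cover : forall n (s : vc_input n) k (le_kn : k <= n),
    is_vertex_cover (revealed s le_kn) (accepted decide s le_kn)
}.

Definition ALG (A : online_alg) n (s : vc_input n) : nat :=
  #|accepted A s (leqnn n)|.

Definition OPT n (s : vc_input n) : nat := min_vertex_cover (graph s).

(* Main.v *)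
Require Import Defs.
From HB Require Import structures.
From mathcomp Require Import all_boot all_order all_algebra.
From mathcomp Require Import reals.

Set Implicit Arguments.
Unset Strict Implicit.
Unset Printing Implicit Defensive.

Import Order.TTheory GRing.Theory Num.Theory.
Local Open Scope ring_scope.

(** The algorithm accepts a vertex exactly when it is adjacent to an earlier
    one: this covers every edge by its later endpoint, never accepts the first
    vertex, and accepts nothing when there is no edge.  Conversely, an
    algorithm with a finite ratio must reject an isolated first vertex, because
    of the edgeless input; on the star whose center arrives first it then has
    to accept all [n - 1] leaves, whereas the center alone is a cover. *)

Local Open Scope nat_scope.

Lemma sgraph_eq (V : finType) (G H : sgraph V) : edges G = edges H -> G = H.
Proof.
case: G H => [E cE] [F cF] /= eqEF; subst F.
by congr SGraph; exact: bool_irrelevance.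
Qed.

Lemma edges_I1 (G : sgraph 'I_1) : edges G = set0.
Proof.
apply/setP => e; rewrite inE; apply/negP => /(forall_inP (card_edges G)) /eqP e2.
by have := max_card (mem e); rewrite e2 card_ord.
Qed.

Lemma is_vertex_coverT (V : finType) (G : sgraph V) : is_vertex_cover G [set: V].
Proof.
apply/forall_inP => e /(forall_inP (card_edges G)) e2.
by rewrite -setI_eq0 setIT -card_gt0 (eqP e2).
Qed.

Lemma min_vertex_cover_leq (V : finType) (G : sgraph V) (C : {set V}) :
  is_vertex_cover G C -> min_vertex_cover G <= #|C|.
Proof.
rewrite /min_vertex_cover.
by case: arg_minnP => [|D _ minD]; [exact: is_vertex_coverT | exact: minD].
Qed.

Lemma min_vertex_cover_gt0 (V : finType) (G : sgraph V) :
  edges G != set0 -> 0 < min_vertex_cover G.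
Proof.
case/set0Pn => e eG; rewrite /min_vertex_cover.
case: arg_minnP => [|C coverC _]; first exact: is_vertex_coverT.
rewrite lt0n cards_eq0; apply: contraTneq coverC => ->.
by apply/forall_inPn; exists e; rewrite // negbK -setI_eq0 setI0.
Qed.

Lemma mem_revealed n (s : vc_input n) k (le_kn : k <= n) (e : {set 'I_k}) :
  (e \in edges (revealed s le_kn)) =
  ([set arrival s (widen_ord le_kn i) | i in e] \in edges (graph s)).
Proof. by rewrite inE. Qed.

(** Used to pull an edge of a later revealed graph back to the moment when its last endpoint
    arrived, which is when the decision on that endpoint was taken. *)
Lemma revealed_widen n (s : vc_input n) j k (le_jk : j <= k) (le_kn : k <= n)
    (le_jn : j <= n) (e : {set 'I_j}) :
  (e \in edges (revealed s le_jn)) =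
  ([set widen_ord le_jk i | i in e] \in edges (revealed s le_kn)).
Proof.
rewrite !mem_revealed -imset_comp.
suff -> : [set arrival s (widen_ord le_jn i) | i in e] =
  [set (fun i => arrival s (widen_ord le_kn i)) (widen_ord le_jk i) | i in e].
  by [].
by apply: eq_imset => i; congr (arrival s _); apply: val_inj.
Qed.

Definition accept_adjacent : decision_rule :=
  fun k G => [exists e in edges G, ord_max \in e].

Lemma accept_adjacent_cover n (s : vc_input n) k (le_kn : k <= n) :
  is_vertex_cover (revealed s le_kn) (accepted accept_adjacent s le_kn).
Proof.
apply/forall_inP => e eG.
have e2 : #|e| == 2 := forall_inP (card_edges (revealed s le_kn)) e eG.
have [i0 i0e] : exists i, i \in e by apply/card_gt0P; rewrite (eqP e2).
(* [j] is the endpoint of [e] that arrives last; it is the one shown to be accepted. *)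
have [j je maxj] := arg_maxnP (fun i : 'I_k => nat_of_ord i) i0e.
apply/pred0Pn; exists j; rewrite /= [j \in e]je inE.
(* The witness is [e] restricted to the first [j.+1] positions; by maximality of [j] this loses no
   endpoint, so its image is [e] again. *)
apply/exists_inP; exists [set i | widen_ord (ltn_ord j) i \in e].
  rewrite (revealed_widen s (ltn_ord j) le_kn).
  rewrite (_ : imset _ _ = e) //; apply/setP => i.
  apply/imsetP/idP => [[l]|ie]; first by rewrite inE => le ->.
  have lt_ij : i < j.+1 by exact: maxj.
  have widen_i : widen_ord (ltn_ord j) (Ordinal lt_ij) = i by apply: val_inj.
  by exists (Ordinal lt_ij); rewrite ?inE widen_i.
by rewrite inE (_ : widen_ord _ _ = j) //; apply: val_inj.
Qed.

Definition accept_adjacent_alg : online_alg := OnlineAlg accept_adjacent_cover.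

Lemma revealed_set0 n (s : vc_input n) k (le_kn : k <= n) :
  edges (graph s) = set0 -> edges (revealed s le_kn) = set0.
Proof. by move=> G0; apply/setP => e; rewrite mem_revealed G0 !inE. Qed.

Lemma accept_adjacent_upper n (s : vc_input n) :
  ALG accept_adjacent_alg s <= n.-1 * OPT s.
Proof.
rewrite /ALG /OPT.
(* Without edges both sides are 0. Otherwise [OPT s] is at least 1, and bounding the number of
   accepted vertices by [n.-1] suffices. *)
have [G0|/min_vertex_cover_gt0 OPT_gt0] := eqVneq (edges (graph s)) set0.
  rewrite (_ : accepted _ _ _ = set0) ?cards0 //; apply/setP => i; rewrite !inE.
  by apply/exists_inP => -[e]; rewrite revealed_set0 ?inE.
apply: leq_trans (leq_pmulr _ OPT_gt0).
case: n s {OPT_gt0} => [|n] s; first by rewrite (leq_trans (max_card _)) ?card_ord.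
have others : #|[set~ @ord0 n]| = n by rewrite cardsC1 card_ord.
rewrite /= -[leqRHS]others.
(* The first vertex is rejected: the graph revealed at its arrival has one vertex, hence no edge. *)
apply/subset_leq_card/subsetP => i; rewrite !inE; apply: contraTneq => ->.
by apply/exists_inP => -[e]; rewrite edges_I1 inE.
Qed.

Definition identity_input n (G : sgraph 'I_n) : vc_input n :=
  @VCInput n _ G id (Bijective (frefl _) (frefl _)).

Lemma card_edgeless (V : finType) : [forall e in set0 : {set {set V}}, #|e| == 2].
Proof. by apply/forall_inP => e; rewrite inE. Qed.

Definition edgeless (V : finType) : sgraph V := SGraph (card_edgeless V).

Lemma OPT_edgeless n : OPT (identity_input (edgeless 'I_n)) = 0.
Proof.
apply/eqP; rewrite -leqn0 -(cards0 'I_n); apply: min_vertex_cover_leq.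
by apply/forall_inP => e; rewrite inE.
Qed.

Definition star_edges (V : finType) (x : V) : {set {set V}} :=
  [set [set x; y] | y in [set~ x]].

Lemma card_star_edges (V : finType) (x : V) :
  [forall e in star_edges x, #|e| == 2].
Proof.
apply/forall_inP => e /imsetP[y]; rewrite !inE => yx ->.
by rewrite cards2 [x == y]eq_sym yx.
Qed.

Definition star (V : finType) (x : V) : sgraph V := SGraph (card_star_edges x).

(** The center covers every edge. Equality fails for [n = 1], where the star has no edge. *)
Lemma OPT_star n (x : 'I_n) : OPT (identity_input (star x)) <= 1.
Proof.
rewrite -(cards1 x); apply: min_vertex_cover_leq.
apply/forall_inP => e /imsetP[y _ ->]; apply/pred0Pn; exists x.
by rewrite /= !inE eqxx.
Qed.

(** A graph on one vertex is unique, so the first decision is made on the same data for every input.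
    This carries the rejection forced by the edgeless input over to the star. *)
Lemma accepted_first (A : online_alg) n (s t : vc_input n.+1) :
  (ord0 \in accepted A s (leqnn _)) = (ord0 \in accepted A t (leqnn _)).
Proof. by rewrite !inE; congr (decide A _); apply: sgraph_eq; rewrite !edges_I1. Qed.

Lemma ALG_star (A : online_alg) n :
  ord0 \notin accepted A (identity_input (star ord0)) (leqnn n.+1) ->
  n <= ALG A (identity_input (star (@ord0 n))).
Proof.
have leaves : #|[set~ @ord0 n]| = n by rewrite cardsC1 card_ord.
move=> rej0; rewrite -[leqLHS]leaves.
apply/subset_leq_card/subsetP => i; rewrite !inE => i0.
(* The edge from the center to the leaf [i] must be covered at the end; as [ord0] is rejected, only
   [i] can cover it. *)
have e_rev : [set ord0; i] \in
    edges (revealed (identity_input (star (@ord0 n))) (leqnn n.+1)).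
  rewrite mem_revealed (_ : imset _ _ = [set ord0; i]).
    by apply/imsetP; exists i; rewrite ?inE.
  rewrite -[RHS]imset_id; apply: eq_imset => j; exact: val_inj.
have /pred0Pn[j] := forall_inP (decide_cover A _ (leqnn n.+1)) _ e_rev.
rewrite /= in_set2 => /andP[/orP[]/eqP-> accj]; last by move: accj; rewrite inE.
by rewrite accj in rej0.
Qed.

Local Open Scope ring_scope.

Theorem theorem10 (R : realType) :
  (exists A : online_alg, forall (n : nat) (s : vc_input n), (1 <= n)%N ->
     (ALG A s)%:R <= (n%:R - 1) * (OPT s)%:R :> R)
  /\
  (forall (A : online_alg) (n : nat), (1 <= n)%N ->
     forall c : R, 0 <= c ->
     (forall s : vc_input n, (ALG A s)%:R <= c * (OPT s)%:R) ->
     n%:R - 1 <= c).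
Proof.
split.
  exists accept_adjacent_alg => -[//|n] s _.
  by rewrite -natr1 addrK -natrM ler_nat accept_adjacent_upper.
move=> A [//|n] _ c c_ge0 ratio; rewrite -natr1 addrK.
(* Here the optimum is 0, so whatever the value of [c], nothing may be accepted. *)
have := ratio (identity_input (edgeless _)).
rewrite OPT_edgeless mulr0 lern0 cards_eq0 => /eqP acc0.
have rej0 : ord0 \notin accepted A (identity_input (star ord0)) (leqnn n.+1).
  by rewrite (accepted_first A _ (identity_input (edgeless _))) acc0 inE.
apply: le_trans (_ : (ALG A (identity_input (star (@ord0 n))))%:R <= _).
  by rewrite ler_nat ALG_star.
apply: le_trans (ratio _) _.
(* An optimum of at most 1 gives the bound [c] because [c] is nonnegative. *)
by rewrite ler_piMr // lern1 OPT_star.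
Qed.
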